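(* Let $(J_{i,j})_{i,j\ge1}$ be real numbers with $J_{i,j}=J_{j,i}$ for all $i,j\ge1$, and let $K_{i,j}=0$ for all $i,j\ge1$. Assume that there is a non-negative real sequence $(\rho_i)_{i\ge1}$ with $J_{i,j}\le\rho_i\rho_j$ for all $i,j\ge1$ and $\lim_{i\to\infty}\rho_i/i=0$, and that there is $\delta>0$ with $J_{i,j}\ge\delta$ for all $i,j\ge1$. Let $(a^0,b^0)\in X_0^+\times X_0^+$, and let $(a,b)$ be a continuously differentiable solution (each $a_i$, $b_i$ is continuously differentiable) on $[0,\infty)$ of the coagulation--annihilation system with rates $K=0$ and $J$ and initial data $(a^0,b^0)$, satisfying $$\|a(t)\|_1\le\|a^0\|_1,\qquad\|b(t)\|_1\le\|b^0\|_1,\qquad t\ge0 .$$ Then: (i) If $\|a^0\|_0=\|b^0\|_0$, then $\lim_{t\to\infty}\|a(t)\|_0=0$ and $\lim_{t\to\infty}\|b(t)\|_0=0$. (ii) If $\|a^0\|_0>\|b^0\|_0$, then $\|b(t)\|_0\to0$ and $\|a(t)\|_0\to\|a^0\|_0-\|b^0\|_0$ as $t\to\infty$. If $\|a^0\|_0<\|b^0\|_0$, then $\|a(t)\|_0\to0$ and $\|b(t)\|_0\to\|b^0\|_0-\|a^0\|_0$ as $t\to\infty$.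
   Context: For $p\in\mathbb{R}$ and a real sequence $x=(x_i)_{i\ge1}$, $\|x\|_p=\sum_{i=1}^\infty i^p|x_i|\in[0,\infty]$; $X_p$ is the space of $x$ with $\|x\|_p<\infty$, and $X_p^+=\{x\in X_p: x_i\ge0\text{ for all }i\ge1\}$. With $K=0$ the coagulation--annihilation system is, for $i\in\mathbb{N}=\{1,2,\dots\}$ and $t>0$, $$\frac{da_i}{dt}=-\sum_{j=1}^\infty J_{i,j}a_ib_j,\qquad\frac{db_i}{dt}=-\sum_{j=1}^\infty J_{i,j}b_ia_j,\qquad a_i(0)=a_i^0\ge0,\quad b_i(0)=b_i^0\ge0.$$ Solution: a pair $(a,b)=((a_i)_{i\ge1},(b_i)_{i\ge1})$ of sequences of non-negative functions is a solution on $[0,\infty)$ with initial data $(a^0,b^0)$ if (1) $a_i,b_i\in C([0,\infty))$ for each $i\in\mathbb{N}$; (2) for each $i\in\mathbb{N}$ and $t\ge0$, the functions $\sum_{j=1}^\infty J_{i,j}a_j$ and $\sum_{j=1}^\infty J_{i,j}b_j$ belong to $L^1(0,t)$; (3) for each $i\in\mathbb{N}$ and $t>0$, $$a_i(t)=a_i^0-\int_0^ta_i(s)\sum_{j=1}^\infty J_{i,j}b_j(s)\,ds,\qquad b_i(t)=b_i^0-\int_0^tb_i(s)\sum_{j=1}^\infty J_{i,j}a_j(s)\,ds .$$ *)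

(* Defs.v *)
From HB Require Import structures.
From mathcomp Require Import all_boot all_order all_algebra.
From mathcomp Require Import all_classical all_reals all_analysis.

Set Implicit Arguments.
Unset Strict Implicit.
Unset Printing Implicit Defensive.

Import Order.TTheory GRing.Theory Num.Theory.
Import numFieldNormedType.Exports.

Local Open Scope classical_set_scope.
Local Open Scope ring_scope.

(* A sequence (x_i)_{i >= 1} is a function on nat whose value at 0 is never
   used: every sum and every quantifier below starts at index 1.  Likewise, a
   function of time t in [0, oo) is a total function on R whose values at
   negative times are never used. *)

Definition norm_X (R : realType) (p : R) (x : nat -> R) : \bar R :=
  (\sum_(1 <= i <oo) (i%:R `^ p * `|x i|)%:E)%E.

Definition space_X (R : realType) (p : R) : set (nat -> R) :=
  [set x | (norm_X p x < +oo)%E].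

Definition space_Xplus (R : realType) (p : R) : set (nat -> R) :=
  [set x | space_X p x /\ forall i, (1 <= i)%N -> 0 <= x i].

Definition rate (R : realType) (J : nat -> nat -> R) (i : nat)
    (c : nat -> R -> R) (s : R) : \bar R :=
  (\sum_(1 <= j <oo) (J i j * c j s)%:E)%E.

(* The rates may be +oo on a null set of times, so the integral equations are
   stated in the extended reals, with the convention 0 * +oo = 0. *)
Record is_solution (R : realType) (J : nat -> nat -> R)
    (a0 b0 : nat -> R) (a b : nat -> R -> R) : Prop := IsSolution {
  solution_ge0 : forall (i : nat) (t : R), (1 <= i)%N -> 0 <= t ->
    0 <= a i t /\ 0 <= b i t;
  solution_continuous : forall i, (1 <= i)%N ->
    {within `[0, +oo[, continuous (a i)} /\
    {within `[0, +oo[, continuous (b i)};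
  solution_integrable : forall (i : nat) (t : R), (1 <= i)%N -> 0 <= t ->
    (@lebesgue_measure R).-integrable `]0, t[ (rate J i a) /\
    (@lebesgue_measure R).-integrable `]0, t[ (rate J i b);
  solution_integral : forall (i : nat) (t : R), (1 <= i)%N -> 0 < t ->
    ((a i t)%:E = (a0 i)%:E -
       \int[lebesgue_measure]_(s in `[0%R, t]) ((a i s)%:E * rate J i b s))%E /\
    ((b i t)%:E = (b0 i)%:E -
       \int[lebesgue_measure]_(s in `[0%R, t]) ((b i s)%:E * rate J i a s))%E
}.

(* Continuous differentiability on [0, oo); the derivative at 0 is one-sided. *)
Definition continuously_differentiable (R : realType) (f : R -> R) : Prop :=
  exists df : R -> R,
    {within `[0, +oo[, continuous df} /\
    forall t : R, 0 <= t ->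
      (f s - f t) / (s - t) @[s --> within `[0, +oo[ t^'] --> df t.

(* Main.v *)
Require Import Defs.
From HB Require Import structures.
From mathcomp Require Import all_boot all_order all_algebra.
From mathcomp Require Import all_classical all_reals all_analysis.
From mathcomp Require Import measurable_realfun.

Set Implicit Arguments.
Unset Strict Implicit.
Unset Printing Implicit Defensive.

Import Order.TTheory GRing.Theory Num.Theory.
Import numFieldNormedType.Exports.

Local Open Scope classical_set_scope.
Local Open Scope ring_scope.

(* Summing the integral equations over i by Tonelli, and writing A, B for the
   norms of a(t), b(t) in X_0, gives A(t) + int_0^t D = A(0) and
   B(t) + int_0^t D = B(0) with the same D = sum_(i,j) J_ij a_i b_j, since J is
   symmetric.  Hence A - B is conserved.  Each a_i and b_i is nonincreasing,
   so D >= delta A(t) B(t) on ]0, t] and delta t A(t) B(t) <= A(0).  If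
   A(0) >= B(0), then A >= B and B(t)^2 <= A(0) / (delta t) tends to 0. *)

(** * Norms as series, and the symmetry between the species *)

Lemma continuous_ray_measurable_fun (R : realType) (f : R -> R) (t : R) :
  {within `[0, +oo[, continuous f} -> measurable_fun `[0, t] f.
Proof.
move=> cf; apply: subspace_continuous_measurable_fun => //.
by apply: continuous_subspaceW cf; apply: subset_itvl; rewrite bnd_simp.
Qed.

(** From here on the index [i.+1] carries the condition that indices are at least 1, so that facts
    about series over all of [nat] apply directly. *)
Lemma eseries_from1 (R : realType) (f : nat -> \bar R) :
  (\sum_(1 <= i <oo) f i = \sum_(i <oo) f i.+1)%E.
Proof.
rewrite /lim; congr get; apply/funext => l.
rewrite -[in LHS]cvg_shiftS /=.
by under eq_fun do rewrite big_add1 /=.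
Qed.

Lemma norm_X0E (R : realType) (x : nat -> R) :
  (forall i, (1 <= i)%N -> 0 <= x i) ->
  norm_X 0 x = (\sum_(i <oo) (x i.+1)%:E)%E.
Proof.
move=> x0; rewrite /norm_X eseries_from1.
by apply: eq_eseriesr => i _; rewrite powRr0 mul1r ger0_norm// x0.
Qed.

Lemma norm_X_ge0 (R : realType) (p : R) (x : nat -> R) : (0 <= norm_X p x)%E.
Proof. by apply: nneseries_ge0 => i _ _; rewrite lee_fin mulr_ge0// powR_ge0. Qed.

(** The system is symmetric in the two species, so facts proved for [a] alone transfer to [b]
    through this exchange. *)
Lemma is_solution_swap (R : realType) (J : nat -> nat -> R)
    (a0 b0 : nat -> R) (a b : nat -> R -> R) :
  is_solution J a0 b0 a b -> is_solution J b0 a0 b a.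
Proof.
move=> [h1 h2 h3 h4]; split.
- by move=> i t i1 t0; have [] := h1 i t i1 t0.
- by move=> i i1; have [] := h2 i i1.
- by move=> i t i1 t0; have [] := h3 i t i1 t0.
- by move=> i t i1 t0; have [] := h4 i t i1 t0.
Qed.

(** * The total reaction rate *)

Lemma rateE (R : realType) (J : nat -> nat -> R) (i : nat)
    (c : nat -> R -> R) (s : R) :
  rate J i c s = (\sum_(j <oo) (J i j.+1 * c j.+1 s)%:E)%E.
Proof. exact: eseries_from1. Qed.

(** This is D of the overview, grouped as the sum over [i] of the losses of [a i], so that
    integrating it matches summing the integral equations. *)
Definition reaction (R : realType) (J : nat -> nat -> R)
    (a b : nat -> R -> R) (s : R) : \bar R :=
  (\sum_(i <oo) (a i.+1 s)%:E * rate J i.+1 b s)%E.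

Lemma reactionE (R : realType) (J : nat -> nat -> R) (a b : nat -> R -> R)
    (s : R) :
  (forall i j, 0 <= J i.+1 j.+1) -> (forall j, 0 <= b j.+1 s) ->
  reaction J a b s =
  (\sum_(i <oo) \sum_(j <oo) (a i.+1 s * (J i.+1 j.+1 * b j.+1 s))%:E)%E.
Proof.
move=> J0 b_ge0; apply: eq_eseriesr => i _.
rewrite rateE -nneseriesZl; last first.
  by move=> j _; rewrite lee_fin mulr_ge0.
by apply: eq_eseriesr => j _; rewrite EFinM.
Qed.

(** All terms are nonnegative, so the double series may be summed in either order; symmetry of [J]
    then exchanges the roles of [a] and [b]. *)
Lemma reaction_sym (R : realType) (J : nat -> nat -> R) (a b : nat -> R -> R)
    (s : R) :
  (forall i j, 0 <= J i.+1 j.+1) ->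
  (forall i j, J i.+1 j.+1 = J j.+1 i.+1) ->
  (forall j, 0 <= a j.+1 s) -> (forall j, 0 <= b j.+1 s) ->
  reaction J a b s = reaction J b a s.
Proof.
move=> J0 Jsym a_ge0 b_ge0; rewrite !reactionE// nneseries_interchange; last first.
  by move=> i j; rewrite lee_fin !mulr_ge0.
apply: eq_eseriesr => j _; apply: eq_eseriesr => i _.
by rewrite Jsym mulrC -mulrA mulrCA.
Qed.

Lemma reaction_ge (R : realType) (J : nat -> nat -> R) (a b : nat -> R -> R)
    (delta s t : R) :
  0 <= delta -> (forall i j, delta <= J i.+1 j.+1) ->
  (forall j, 0 <= a j.+1 t <= a j.+1 s) ->
  (forall j, 0 <= b j.+1 t <= b j.+1 s) ->
  (\sum_(j <oo) (b j.+1 t)%:E)%E \is a fin_num ->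
  (delta%:E * ((\sum_(i <oo) (a i.+1 t)%:E) * (\sum_(j <oo) (b j.+1 t)%:E))
     <= reaction J a b s)%E.
Proof.
move=> d0 dJ a_ge b_ge bfin.
have /= ja i : 0 <= a i.+1 t by have /andP[] := a_ge i.
have /= jb i : 0 <= b i.+1 t by have /andP[] := b_ge i.
rewrite muleCA muleC.
(* Write A and B for the sums of [a] and [b] at time [t]. As B is finite, delta B is a real scalar
   and moves inside the sum over [i]; what remains is the termwise bound of delta B a_i(t) by the
   loss of [a i] at time [s]. *)
rewrite -(fineK bfin) -EFinM -nneseriesZl; last by move=> i _; rewrite lee_fin.
apply: lee_nneseries => [i _ _|i _].
  rewrite -EFinM lee_fin !mulr_ge0// fine_ge0//.
  by apply: nneseries_ge0 => j _ _; rewrite lee_fin.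
rewrite muleC; apply: lee_pmul.
- by rewrite lee_fin.
- rewrite lee_fin mulr_ge0// fine_ge0//.
  by apply: nneseries_ge0 => j _ _; rewrite lee_fin.
- by rewrite lee_fin; have /andP[] := a_ge i.
rewrite EFinM fineK// rateE -nneseriesZl; last first.
  by move=> j _; rewrite lee_fin.
apply: lee_nneseries => [j _ _|j _]; first by rewrite -EFinM lee_fin mulr_ge0.
by rewrite -EFinM lee_fin ler_pM//; have /andP[] := b_ge j.
Qed.

(** * Loss terms and balance laws of a solution *)

Section solution.
Context (R : realType) (J : nat -> nat -> R) (a0 b0 : nat -> R)
  (a b : nat -> R -> R).
Hypothesis hsol : is_solution J a0 b0 a b.
Hypothesis J0 : forall i j, 0 <= J i.+1 j.+1.

Lemma solution_a_ge0 i t : 0 <= t -> 0 <= a i.+1 t.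
Proof. by move=> t0; have [] := solution_ge0 hsol (i := i.+1) isT t0. Qed.

Lemma solution_b_ge0 i t : 0 <= t -> 0 <= b i.+1 t.
Proof. by move=> t0; have [] := solution_ge0 hsol (i := i.+1) isT t0. Qed.

Lemma rate_ge0 i t : 0 <= t -> (0 <= rate J i.+1 b t)%E.
Proof.
move=> t0; rewrite rateE; apply: nneseries_ge0 => j _ _.
by rewrite lee_fin mulr_ge0// solution_b_ge0.
Qed.

Lemma loss_ge0 i t : 0 <= t -> (0 <= (a i.+1 t)%:E * rate J i.+1 b t)%E.
Proof. by move=> t0; rewrite mule_ge0 ?rate_ge0// lee_fin solution_a_ge0. Qed.

Lemma measurable_solution_a i (t : R) : measurable_fun `[0, t] (a i.+1).
Proof.
apply: continuous_ray_measurable_fun.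
by have [] := solution_continuous hsol (i := i.+1) isT.
Qed.

Lemma measurable_solution_b i (t : R) : measurable_fun `[0, t] (b i.+1).
Proof.
apply: continuous_ray_measurable_fun.
by have [] := solution_continuous hsol (i := i.+1) isT.
Qed.

Lemma measurable_loss i (t : R) :
  measurable_fun `[0, t] (fun s => (a i.+1 s)%:E * rate J i.+1 b s)%E.
Proof.
apply: emeasurable_funM.
  by apply/measurable_EFinP; exact: measurable_solution_a.
rewrite (funext (rateE J i.+1 b)).
apply: (ge0_emeasurable_sum (P := xpredT)) => [j x|j _].
  rewrite /= in_itv/= => /andP[x0 _] _.
  by rewrite lee_fin mulr_ge0 ?J0// solution_b_ge0.
by apply/measurable_EFinP; apply: measurable_funM => //; exact: measurable_solution_b.
Qed.

(** The integral is nonnegative, and it cannot be +oo because the left side of the integral equation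
    is real; hence it may be moved across. *)
Lemma solution_balance i (t : R) : 0 < t ->
  ((a i.+1 t)%:E + \int[lebesgue_measure]_(s in `[0%R, t])
     ((a i.+1 s)%:E * rate J i.+1 b s) = (a0 i.+1)%:E)%E.
Proof.
move=> t0; have [+ _] := solution_integral hsol (i := i.+1) isT t0.
set I := (\int[_]_(_ in _) _)%E => ->.
have : (0 <= I)%E.
  by apply: integral_ge0 => x; rewrite /= in_itv/= => /andP[x0 _]; exact: loss_ge0.
have [+ _] := solution_integral hsol (i := i.+1) isT t0; rewrite -/I.
case: I => // r; rewrite -!EFinB => _ _.
by rewrite -EFinD subrK.
Qed.

(** The balance has a constant right side, while the integral of the nonnegative loss grows with
    time. The balance is available at positive times, whence [0 < s]. *)
Lemma solution_nonincreasing i s t : 0 < s -> s <= t -> a i.+1 t <= a i.+1 s.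
Proof.
move=> s0 st; have t0 := lt_le_trans s0 st.
have : (\int[lebesgue_measure]_(s in `[0%R, s]) ((a i.+1 s)%:E * rate J i.+1 b s)
  <= \int[lebesgue_measure]_(s in `[0%R, t]) ((a i.+1 s)%:E * rate J i.+1 b s))%E.
  apply: ge0_subset_integral => //; first exact: measurable_loss.
    by move=> x; rewrite /= in_itv/= => /andP[x0 _]; exact: loss_ge0.
  by apply: subset_itvl; rewrite bnd_simp.
have := solution_balance i s0; have := solution_balance i t0.
set I := (\int[_]_(_ in _) _)%E; set K := (\int[_]_(_ in _) _)%E.
case: I => // x; case: K => // y; rewrite -!EFinD lee_fin => -[<-] [] e h.
by rewrite -(lerD2r y) e lerD2l.
Qed.

(** The identity is stated in the extended reals, so that finiteness of the norm at time [t] can be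
    deduced from it when the initial norm is finite. *)
Lemma norm_balance t : (forall i, (1 <= i)%N -> 0 <= a0 i) -> 0 < t ->
  (norm_X 0 (a^~ t) + \int[lebesgue_measure]_(s in `[0%R, t]) reaction J a b s
    = norm_X 0 a0)%E.
Proof.
move=> a00 t0; rewrite !norm_X0E//; last first.
  by move=> [//|i] _; exact/solution_a_ge0/ltW.
rewrite integral_nneseries//; last 2 first.
- by move=> n; exact: measurable_loss.
- by move=> n x; rewrite /= in_itv/= => /andP[x0 _]; exact: loss_ge0.
rewrite -nneseriesD; last 2 first.
- by move=> i _ _; rewrite lee_fin solution_a_ge0// ltW.
- move=> i _ _; apply: integral_ge0 => x; rewrite /= in_itv/= => /andP[x0 _].
  exact: loss_ge0.
by apply: eq_eseriesr => i _; exact: solution_balance.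
Qed.

Lemma measurable_reaction (t : R) : measurable_fun `[0, t] (reaction J a b).
Proof.
apply: (ge0_emeasurable_sum (P := xpredT)) => [j x|j _].
  by rewrite /= in_itv/= => /andP[x0 _] _; exact: loss_ge0.
exact: measurable_loss.
Qed.

End solution.

(** * Finiteness, conservation and the product bound *)

Lemma norm_a_fin (R : realType) (J : nat -> nat -> R) (a0 b0 : nat -> R)
    (a b : nat -> R -> R) (t : R) :
  is_solution J a0 b0 a b -> (forall i j, 0 <= J i.+1 j.+1) ->
  space_Xplus 0 a0 -> 0 < t ->
  norm_X 0 (a^~ t) \is a fin_num.
Proof.
move=> hsol J0 [a0fin a00] t0; rewrite ge0_fin_numE ?norm_X_ge0//.
apply: le_lt_trans a0fin; rewrite -(norm_balance hsol J0 a00 t0).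
apply: leeDl; apply: integral_ge0 => s; rewrite /= in_itv/= => /andP[s0 _].
by apply: nneseries_ge0 => i _ _; exact: (loss_ge0 hsol J0).
Qed.

Lemma norm_difference (R : realType) (J : nat -> nat -> R) (a0 b0 : nat -> R)
    (a b : nat -> R -> R) (t : R) :
  is_solution J a0 b0 a b -> (forall i j, 0 <= J i.+1 j.+1) ->
  (forall i j, J i.+1 j.+1 = J j.+1 i.+1) ->
  space_Xplus 0 a0 -> space_Xplus 0 b0 -> 0 < t ->
  fine (norm_X 0 (a^~ t)) - fine (norm_X 0 (b^~ t)) =
  fine (norm_X 0 a0) - fine (norm_X 0 b0).
Proof.
move=> hsol J0 Jsym ha0 hb0 t0; have hsol' := is_solution_swap hsol.
have := norm_a_fin hsol J0 ha0 t0; have := norm_a_fin hsol' J0 hb0 t0.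
have [a0fin a00] := ha0; have [b0fin b00] := hb0.
have := norm_balance hsol J0 a00 t0; have := norm_balance hsol' J0 b00 t0.
rewrite (_ : (\int[_]_(_ in _) reaction J b a _)%E =
  (\int[lebesgue_measure]_(s in `[0%R, t]) reaction J a b s)%E); last first.
  apply: eq_integral => s; rewrite inE/= in_itv/= => /andP[s0 _].
  apply: reaction_sym => // j; first exact: (solution_b_ge0 hsol).
  exact: (solution_a_ge0 hsol).
move: a0fin b0fin; rewrite /space_X/= -!ge0_fin_numE ?norm_X_ge0//.
(* All four norms are real, so the balance laws force the common integral to be real as well, and it
   cancels. *)
move: (norm_X 0 a0) (norm_X 0 b0) (norm_X 0 (a^~ t)) (norm_X 0 (b^~ t)).
move=> [x| |] [y| |] [u| |] [v| |] //.
by case: (integral _ _ _) => [z| |] //= _ _ [<-] [<-] _ _; rewrite [v + z]addrC addrKA.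
Qed.

Lemma norm_product_bound (R : realType) (J : nat -> nat -> R) (a0 b0 : nat -> R)
    (a b : nat -> R -> R) (delta t : R) :
  is_solution J a0 b0 a b -> 0 <= delta ->
  (forall i j, delta <= J i.+1 j.+1) ->
  space_Xplus 0 a0 -> space_Xplus 0 b0 -> 0 < t ->
  delta * (fine (norm_X 0 (a^~ t)) * fine (norm_X 0 (b^~ t))) * t <=
  fine (norm_X 0 a0).
Proof.
move=> hsol d0 dJ ha0 hb0 t0; have hsol' := is_solution_swap hsol.
have J0 i j : 0 <= J i.+1 j.+1 by exact: le_trans (dJ i j).
have afin := norm_a_fin hsol J0 ha0 t0; have bfin := norm_a_fin hsol' J0 hb0 t0.
have [a0fin a00] := ha0.
rewrite -lee_fin fineK; last by rewrite ge0_fin_numE ?norm_X_ge0.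
rewrite -(norm_balance hsol J0 a00 t0).
have Dge0 s : `[0, t]%classic s -> (0 <= reaction J a b s)%E.
  rewrite /= in_itv/= => /andP[s0 _].
  by apply: nneseries_ge0 => i _ _; exact: (loss_ge0 hsol J0).
apply: (@le_trans _ _
  (\int[lebesgue_measure]_(s in `[0%R, t]) reaction J a b s)%E); last first.
  by apply: leeDr; exact: norm_X_ge0.
(* Time 0 is dropped because monotonicity of the components is known from positive times on. *)
apply: (@le_trans _ _
  (\int[lebesgue_measure]_(s in `]0%R, t]) reaction J a b s)%E); last first.
  apply: ge0_subset_integral => //; first exact: (measurable_reaction hsol J0).
  by apply: subset_itvr; rewrite bnd_simp.
set A := norm_X 0 (a^~ t); set B := norm_X 0 (b^~ t).
(* The left side of the claim is the integral of a constant, delta A(t) B(t), over an interval of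
   length [t]. *)
apply: (@le_trans _ _ (\int[lebesgue_measure]_(s in `]0%R, t])
    (delta * (fine A * fine B))%:E)%E).
  rewrite integral_cst//= lebesgue_measure_itv/= lte_fin t0 oppr0 adde0.
  by rewrite EFinM.
apply: ge0_le_integral => //.
- by move=> s _; rewrite lee_fin !mulr_ge0// fine_ge0// norm_X_ge0.
- apply: (measurable_funS _ _ (measurable_reaction hsol J0 (t := t))) => //.
  by apply: subset_itvr; rewrite bnd_simp.
move=> s; rewrite /= in_itv/= => /andP[s0 st].
rewrite 2!EFinM !fineK// /A /B !norm_X0E; last 2 first.
- by move=> [//|i] _; exact/(solution_b_ge0 hsol)/ltW.
- by move=> [//|i] _; exact/(solution_a_ge0 hsol)/ltW.
apply: reaction_ge => //.
- move=> j; rewrite (solution_a_ge0 hsol) ?(ltW t0)//=.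
  exact: (solution_nonincreasing hsol).
- move=> j; rewrite (solution_b_ge0 hsol) ?(ltW t0)//=.
  exact: (solution_nonincreasing hsol').
by move: bfin; rewrite norm_X0E// => -[//|i] _; exact/(solution_b_ge0 hsol)/ltW.
Qed.

(** * Limits of the norms for large times *)

Lemma norm_limits (R : realType) (J : nat -> nat -> R) (a0 b0 : nat -> R)
    (a b : nat -> R -> R) (delta : R) :
  is_solution J a0 b0 a b -> 0 < delta ->
  (forall i j, delta <= J i.+1 j.+1) ->
  (forall i j, J i.+1 j.+1 = J j.+1 i.+1) ->
  space_Xplus 0 a0 -> space_Xplus 0 b0 ->
  (norm_X 0 b0 <= norm_X 0 a0)%E ->
  norm_X 0 (b^~ t) @[t --> +oo] --> 0%E /\
  norm_X 0 (a^~ t) @[t --> +oo] --> (norm_X 0 a0 - norm_X 0 b0)%E.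
Proof.
move=> hsol d0 dJ Jsym ha0 hb0 ba; have hsol' := is_solution_swap hsol.
have J0 i j : 0 <= J i.+1 j.+1 by exact: le_trans (ltW d0) (dJ i j).
have a0fin : norm_X 0 a0 \is a fin_num.
  by rewrite ge0_fin_numE ?norm_X_ge0//; have [] := ha0.
have b0fin : norm_X 0 b0 \is a fin_num.
  by rewrite ge0_fin_numE ?norm_X_ge0//; have [] := hb0.
have bcvg : fine (norm_X 0 (b^~ t)) @[t --> +oo] --> (0 : R).
  apply/cvgrPdist_lt => e e0; near=> t.
  have t0 : 0 < t by near: t; exact: nbhs_pinfty_gt.
  rewrite sub0r normrN ger0_norm ?fine_ge0 ?norm_X_ge0// ltNge.
  (* If B(t) >= e, conservation and A(0) >= B(0) give A(t) >= e too, so the product bound yields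
     delta e^2 t <= A(0). This fails once t > A(0) / (delta e^2), the threshold chosen for [t]
     below. *)
  apply/negP => eb.
  have := norm_product_bound hsol (ltW d0) dJ ha0 hb0 t0.
  have := norm_difference hsol J0 Jsym ha0 hb0 t0.
  have : fine (norm_X 0 b0) <= fine (norm_X 0 a0) by rewrite fine_le.
  move=> le0 /eqP; rewrite subr_eq addrC => /eqP aE.
  have ea : e <= fine (norm_X 0 (a^~ t)).
    by rewrite aE (le_trans eb)// lerDl subr_ge0.
  apply/negP; rewrite -ltNge.
  apply: (@lt_le_trans _ _ (delta * (e * e) * t)).
    rewrite mulrC -ltr_pdivrMr ?mulr_gt0//.
    by near: t; apply: nbhs_pinfty_gt; exact: num_real.
  by rewrite ler_wpM2r ?(ltW t0)// ler_wpM2l ?(ltW d0)// ler_pM// ltW.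
split.
  apply: cvg_EFin => //; near=> t; apply: (norm_a_fin hsol' J0 hb0).
  by near: t; exact: nbhs_pinfty_gt.
rewrite -(fineK a0fin) -(fineK b0fin) -EFinB; apply: cvg_EFin.
  near=> t; apply: (norm_a_fin hsol J0 ha0).
  by near: t; exact: nbhs_pinfty_gt.
(* By conservation, A(t) equals the constant A(0) - B(0) plus B(t) at every positive time, and B(t)
   tends to 0. *)
rewrite -[X in _ --> X]addr0.
apply: cvg_trans (cvgD (cvg_cst _) bcvg); apply: near_eq_cvg; near=> t.
have t0 : 0 < t by near: t; exact: nbhs_pinfty_gt.
rewrite -(norm_difference hsol J0 Jsym ha0 hb0 t0); exact: subrK.
Unshelve. all: by end_near. Qed.

Theorem proposition7p4 (R : realType) (J : nat -> nat -> R)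
  (hJsym : forall i j, (1 <= i)%N -> (1 <= j)%N -> J i j = J j i)
  (hJrho : exists rho : nat -> R,
     [/\ forall i, (1 <= i)%N -> 0 <= rho i,
         forall i j, (1 <= i)%N -> (1 <= j)%N -> J i j <= rho i * rho j &
         rho i / i%:R @[i --> \oo] --> (0 : R)])
  (hJdelta : exists2 delta : R, 0 < delta &
     forall i j, (1 <= i)%N -> (1 <= j)%N -> delta <= J i j)
  (a0 b0 : nat -> R) (ha0 : space_Xplus 0 a0) (hb0 : space_Xplus 0 b0)
  (a b : nat -> R -> R)
  (hsol : is_solution J a0 b0 a b)
  (hC1 : forall i, (1 <= i)%N ->
     continuously_differentiable (a i) /\ continuously_differentiable (b i))
  (hmass : forall t : R, 0 <= t ->
     (norm_X 1 (a^~ t) <= norm_X 1 a0)%E /\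
     (norm_X 1 (b^~ t) <= norm_X 1 b0)%E) :
  (norm_X 0 a0 = norm_X 0 b0 ->
     norm_X 0 (a^~ t) @[t --> +oo] --> 0%E /\
     norm_X 0 (b^~ t) @[t --> +oo] --> 0%E) /\
  ((norm_X 0 b0 < norm_X 0 a0)%E ->
     norm_X 0 (b^~ t) @[t --> +oo] --> 0%E /\
     norm_X 0 (a^~ t) @[t --> +oo] --> (norm_X 0 a0 - norm_X 0 b0)%E) /\
  ((norm_X 0 a0 < norm_X 0 b0)%E ->
     norm_X 0 (a^~ t) @[t --> +oo] --> 0%E /\
     norm_X 0 (b^~ t) @[t --> +oo] --> (norm_X 0 b0 - norm_X 0 a0)%E).
Proof.
have [delta d0 dJ] := hJdelta.
have dJ' i j : delta <= J i.+1 j.+1 by exact: dJ.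
have Jsym i j : J i.+1 j.+1 = J j.+1 i.+1 by exact: hJsym.
have hsol' := is_solution_swap hsol.
have limB := norm_limits hsol d0 dJ' Jsym ha0 hb0.
have limA := norm_limits hsol' d0 dJ' Jsym hb0 ha0.
split; last by split=> /ltW.
(* With equal initial norms the weak inequality holds in both directions, and each orientation gives
   the decay of one species. *)
move=> ab; split; first by apply: (limA _).1; rewrite ab.
by apply: (limB _).1; rewrite ab.
Qed.
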